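(* Let $(A, +)$ be an abelian group and $B$ a subgroup of $A$ of index $2$, so that $A = B \sqcup (a_0 + B)$ for some $a_0 \in A$. Define an operation $\circ$ on $A$ by $$a \circ b = \begin{cases} a + b, & a \in B,\ b \in A,\\ a - b, & a \notin B,\ b \in A.\end{cases}$$ Then $(A, +, \circ)$ is a brace. Moreover, $(A, \circ)$ is isomorphic to a semi-direct product $B \rtimes \mathbb{Z}_2$.
   Context: A (left) brace is a triple $(A, +, \circ)$ where $(A,+)$ is an abelian group, $(A,\circ)$ is a group, and $a \circ (b + c) = (a \circ b) - a + (a \circ c)$ for all $a,b,c \in A$. *)

(* Defs.v *)
From HB Require Import structures.
From mathcomp Require Import all_boot all_algebra.

Set Implicit Arguments.
Unset Strict Implicit.
Unset Printing Implicit Defensive.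

Import GRing.Theory.
Local Open Scope ring_scope.

Definition group_law (T : Type) (op : T -> T -> T) : Prop :=
  exists (e : T) (inv : T -> T),
    [/\ associative op, left_id e op, right_id e op,
        left_inverse e inv op & right_inverse e inv op].

Definition is_brace (A : zmodType) (op : A -> A -> A) : Prop :=
  group_law op /\
  forall a b c : A, op a (b + c) = op a b - a + op a c.

(* Quotient.quot B is the quotient group A / B, so this says #|A / B| = 2 without
   assuming that A is finite. *)
Definition has_index2 (A : zmodType) (B : zmodClosed A) : Prop :=
  exists f : Quotient.quot B -> 'I_2, bijective f.

Definition twisted_add (A : zmodType) (B : zmodClosed A) (a b : A) : A :=
  if a \in B then a + b else a - b.

Definition subgroup_of (A : zmodType) (B : zmodClosed A) : Type :=
  {x : A | x \in B}.

Section SubgroupOf.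
Variables (A : zmodType) (B : zmodClosed A).
HB.instance Definition _ := SubChoice.on (subgroup_of B).
HB.instance Definition _ :=
  [SubChoice_isSubZmodule of subgroup_of B by <:].
End SubgroupOf.

Section SemidirectProduct.
Local Open Scope group_scope.

(* The same data as a group morphism K -> Aut(N). *)
Record aut_action (K N : groupType) := AutAction {
  aact :> K -> N -> N;
  aact_morph : forall k : K, {morph aact k : x y / x * y};
  aact_bij : forall k : K, bijective (aact k);
  aactM : forall (k l : K) (x : N), aact (k * l) x = aact k (aact l x)
}.

(* phi determines the product below; the name also keeps this type apart from
   N * K, which carries the group structure of the direct product. *)
Definition sdprod_type (K N : groupType) (phi : aut_action K N) : Type :=
  (N * K)%type.

Variables (K N : groupType) (phi : aut_action K N).
Local Notation sdT := (sdprod_type phi).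

Lemma aact1 (x : N) : phi 1 x = x.
Proof. by apply: (bij_inj (aact_bij phi 1)); rewrite -aactM mulg1. Qed.

Lemma aactg1 (k : K) : phi k 1 = 1.
Proof. by apply: (mulgI (phi k 1)); rewrite -aact_morph !mulg1. Qed.

HB.instance Definition _ := Choice.on sdT.

Definition sdprod_one : sdT := (1, 1).
Definition sdprod_mul (u v : sdT) : sdT :=
  (u.1 * phi u.2 v.1, u.2 * v.2).
Definition sdprod_inv (u : sdT) : sdT :=
  (phi u.2^-1 u.1^-1, u.2^-1).

Lemma sdprod_mulA : associative sdprod_mul.
Proof.
by move=> u v w; rewrite /sdprod_mul /= aact_morph aactM !mulgA.
Qed.

Lemma sdprod_mul1u : left_id sdprod_one sdprod_mul.
Proof. by case=> x k; rewrite /sdprod_mul /= aact1 !mul1g. Qed.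

Lemma sdprod_mulu1 : right_id sdprod_one sdprod_mul.
Proof. by case=> x k; rewrite /sdprod_mul /= aactg1 !mulg1. Qed.

Lemma sdprod_mulVu : left_inverse sdprod_one sdprod_inv sdprod_mul.
Proof.
by case=> x k; rewrite /sdprod_mul /= -aact_morph !mulVg aactg1.
Qed.

Lemma sdprod_muluV : right_inverse sdprod_one sdprod_inv sdprod_mul.
Proof.
by case=> x k; rewrite /sdprod_mul /= -aactM !mulgV aact1 mulgV.
Qed.

HB.instance Definition _ := isGroup.Build sdT
  sdprod_mulA sdprod_mul1u sdprod_mulu1 sdprod_mulVu sdprod_muluV.

End SemidirectProduct.

(* Main.v *)
Require Import Defs.
From mathcomp Require Import all_boot all_algebra.

Import GRing.Theory.
Local Open Scope ring_scope.

(** Index 2 means that membership in B is a homomorphism from A to Z/2, so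
    [twisted_add B] multiplies the sign (+ on B, - off B) consistently and is
    associative; every element off B is its own inverse. Hence any a0 off B
    generates a complement of order 2 to B, on which it acts by negation, and
    every element of A is uniquely b + k a0 with b in B and k in {0, 1}. *)

Section IndexTwo.
Variables (A : zmodType) (B : zmodClosed A).
Hypothesis idx2 : has_index2 B.

(** When neither [a] nor [b] is in [B], the classes of [a] and [- b] both differ from that of 0.
    There are only two classes, so these coincide and [a + b] is in [B]. *)
Lemma index2_memD (a b : A) : (a + b \in B) = ((a \in B) == (b \in B)).
Proof.
have [aB|aB] := boolP (a \in B); first by rewrite rpredDl.
have [bB|bB] := boolP (b \in B); first by rewrite rpredDr // (negPf aB).
have [f /bij_inj f_inj] := idx2.
pose p (x : A) : Quotient.quot B := \pi_(Quotient.quot B)%qT x.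
have pE x y : (p x == p y) = (x - y \in B) by rewrite Quotient.idealrBE.
rewrite -[b]opprK -pE -(inj_eq f_inj).
have: f (p a) != f (p 0) by rewrite (inj_eq f_inj) pE subr0.
have: f (p (- b)) != f (p 0) by rewrite (inj_eq f_inj) pE subr0 rpredN.
by case: (f (p a)) (f (p (- b))) (f (p 0))
  => [[|[|?]] ?] [[|[|?]] ?] [[|[|?]] ?].
Qed.

Lemma index2_memB (a b : A) : (a - b \in B) = ((a \in B) == (b \in B)).
Proof. by rewrite index2_memD rpredN. Qed.

Lemma index2_exists_notin : exists a0 : A, a0 \notin B.
Proof.
have [f [g fK gK]] := idx2.
(* Which of the two labels denotes the coset [B] is unknown; a difference of representatives of
   distinct cosets avoids the choice. *)
exists (repr (g 0) - repr (g 1)).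
rewrite Quotient.idealrBE !reprK.
by apply/eqP => /(can_inj gK).
Qed.

Lemma twisted_add_mem (a b : A) :
  (twisted_add B a b \in B) = ((a \in B) == (b \in B)).
Proof.
by rewrite /twisted_add; case: ifP => aB; rewrite index2_memD ?rpredN aB.
Qed.

Lemma twisted_add_group_law : group_law (twisted_add B).
Proof.
exists 0, (fun a => if a \in B then - a else a); split.
- move=> a b c; rewrite [RHS]/twisted_add twisted_add_mem /twisted_add.
  by do 2![case: ifP => _] => /=; rewrite ?opprD ?opprK !addrA.
- by move=> a; rewrite /twisted_add rpred0 add0r.
- by move=> a; rewrite /twisted_add subr0 addr0 if_same.
- move=> a; rewrite /twisted_add; case: (boolP (a \in B)) => aB.
    by rewrite rpredN aB addNr.
  by rewrite (negPf aB) subrr.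
- move=> a; rewrite /twisted_add.
  by case: (boolP (a \in B)) => aB; rewrite subrr.
Qed.

End IndexTwo.

(** For the brace identity, let s be the sign attached to [a]: both sides are a + s(b + c), since
    [- a] removes one of the two copies of [a]. *)
Lemma twisted_add_brace (A : zmodType) (B : zmodClosed A) :
  has_index2 B -> is_brace (twisted_add B).
Proof.
move=> idx2; split; first exact: twisted_add_group_law.
move=> a b c; rewrite /twisted_add; case: ifP => _.
  by rewrite [a + b]addrC addrK addrCA addrA.
by rewrite [a - b]addrC addrK addrCA opprD.
Qed.

Section NegationAction.
Variable V : zmodType.

Definition neg_act (k : 'Z_2) (x : V) : V := if k == 0 then x else - x.

Lemma neg_act_morph (k : Algebra.to_multiplicative 'Z_2) :
  {morph (neg_act k : Algebra.to_multiplicative V -> Algebra.to_multiplicative V)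
    : x y / (x * y)%g}.
Proof. by move=> x y; rewrite /neg_act; case: ifP => // _; apply: opprD. Qed.

Lemma neg_act_bij (k : 'Z_2) : bijective (neg_act k).
Proof.
by exists (neg_act k) => x; rewrite /neg_act; case: (k == 0); rewrite ?opprK.
Qed.

Lemma neg_actD (k l : 'Z_2) (x : V) :
  neg_act (k + l) x = neg_act k (neg_act l x).
Proof.
by case: k l => [[|[|?]] ?] [[|[|?]] ?] //; rewrite /neg_act /= opprK.
Qed.

(** The product of [Algebra.to_multiplicative] unfolds to addition, so [neg_actD] serves as the
    action law by conversion. *)
Definition neg_action :
    aut_action (Algebra.to_multiplicative 'Z_2) (Algebra.to_multiplicative V) :=
  AutAction neg_act_morph neg_act_bij neg_actD.

End NegationAction.

Section Splitting.
Variables (A : zmodType) (B : zmodClosed A) (a0 : A).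
Hypotheses (idx2 : has_index2 B) (a0B : a0 \notin B).

Local Notation sdB := (sdprod_type (neg_action (subgroup_of B))).

(** The default [0] of [insubd] is never reached: if [a] and [a0] are both off [B], index 2 puts
    [a - a0] in [B]. *)
Definition sd_split (a : A) : sdB :=
  if a \in B then (insubd 0 a, 0) else (insubd 0 (a - a0), 1).

Definition sd_join (u : sdB) : A :=
  val (u.1 : subgroup_of B) + (if u.2 == 0 :> 'Z_2 then 0 else a0).

Lemma sd_splitK : cancel sd_split sd_join.
Proof.
move=> a; rewrite /sd_split /sd_join; case: ifP => aB /=.
  by rewrite insubdK // addr0.
by rewrite insubdK ?subrK // unfold_in index2_memB // aB (negPf a0B).
Qed.

Lemma sd_joinK : cancel sd_join sd_split.
Proof.
case=> b k; rewrite /sd_split /sd_join /=.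
have bB : val (b : subgroup_of B) \in B by exact: (valP (b : subgroup_of B)).
case: k => [[|[|?]] k2] //=.
  rewrite addr0 bB valKd; congr pair; exact: val_inj.
rewrite rpredDl // (negPf a0B) addrK valKd; congr pair; exact: val_inj.
Qed.

(** [sd_join u] lies in [B] exactly when [u.2] is 0, so the sign chosen by [twisted_add] is the one
    by which [u.2] acts. *)
Lemma sd_joinM (u v : sdB) :
  sd_join (u * v)%g = twisted_add B (sd_join u) (sd_join v).
Proof.
case: u v => [b k] [c l].
have bB : val (b : subgroup_of B) \in B by exact: (valP (b : subgroup_of B)).
case: k l => [[|[|?]] k2] [[|[|?]] l2] //;
  rewrite /sd_join /twisted_add /= rpredDl // ?rpred0 ?(negPf a0B) ?addr0 //.
- by rewrite addrA.
- by rewrite addrAC.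
(* Both factors are off [B]: the two copies of [a0] cancel, matching 1 + 1 = 0 in ['Z_2]. *)
- by rewrite opprD addrACA subrr addr0.
Qed.

End Splitting.

Theorem proposition6p3 (A : zmodType) (B : zmodClosed A) :
  has_index2 B ->
  is_brace (twisted_add B) /\
  exists (phi : aut_action (Algebra.to_multiplicative 'Z_2)
                         (Algebra.to_multiplicative (subgroup_of B)))
         (f : A -> sdprod_type phi),
    bijective f /\
    forall a b : A, f (twisted_add B a b) = (f a * f b)%g.
Proof.
move=> idx2; split; first exact: twisted_add_brace.
have [a0 a0B] := index2_exists_notin A B idx2.
have joinK := sd_joinK A B a0 a0B.
have splitK := sd_splitK A B a0 idx2 a0B.
exists (neg_action (subgroup_of B)), (sd_split A B a0).
split; first by exists (sd_join A B a0).
(* Multiplicativity passes from the injective [sd_join] to its inverse. *)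
by move=> a b; apply: (can_inj joinK); rewrite sd_joinM // !splitK.
Qed.
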